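(* Let $G$ be a finite transitive permutation group on $\Omega$, and suppose that $D(G)\neq G$. Let $\alpha\in\Omega$ and let $G_\alpha$ be the stabiliser of $\alpha$ in $G$, regarded as a permutation group on $\Omega\setminus\{\alpha\}$. Then at least half the elements of $G_\alpha$ are derangements (on $\Omega\setminus\{\alpha\}$), and $G_\alpha=D(G_\alpha)$.
   Context: For a finite permutation group $X$ (not necessarily transitive), a derangement in $X$ is an element with no fixed points, and $D(X)$ denotes the subgroup of $X$ generated by the derangements in $X$. *)

(* Defs.v *)
From mathcomp Require Import all_boot all_fingroup.

Set Implicit Arguments.
Unset Strict Implicit.
Unset Printing Implicit Defensive.

Import GroupScope.

(* A permutation group on a subset S of a finite type T is represented, as in
   perm.v, by a group X of permutations of T supported on S (X \subset Sym S);
   S = [set: T] gives the permutation groups on T itself.  The set S is an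
   explicit argument since being a derangement depends on the permuted set:
   points outside S are fixed by X and have to be ignored. *)
Definition derangements (T : finType) (S : {set T}) (X : {set {perm T}}) :
    {set {perm T}} :=
  [set g in X | [forall x in S, g x != x]].

Definition derangement_subgroup (T : finType) (S : {set T})
    (X : {set {perm T}}) : {set {perm T}} :=
  <<derangements S X>>.

(* A point stabiliser is a permutation group on the remaining points. *)
Lemma point_stabiliser_sub_Sym (T : finType) (G : {group {perm T}})
    (alpha : T) : 'C_G[alpha | 'P] \subset Sym [set~ alpha].
Proof.
apply/subsetP=> g /setIP[_ /astab1P fix_a]; rewrite inE.
apply/subsetP=> x; rewrite inE in_setC1; apply: contraNneq => ->.
by apply/eqP.
Qed.

(* Main.v *)
Require Import Defs.
From mathcomp Require Import all_boot all_fingroup.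

(** By the orbit-counting lemma the elements of [G] have one fixed point on
    average, while those outside [D = D(G)] have at least one each.  Hence
    those of [D] have at most one on average, i.e. [D] is transitive; their
    average is then exactly one, so every element of [G] outside [D] has
    exactly one fixed point.  Consequently the elements of [G_alpha] outside
    [D_alpha] are derangements on the other points; as [D] is transitive and
    proper, [D_alpha] is a proper subgroup of [G_alpha], so they make up at
    least half of [G_alpha] and generate it. *)

Set Implicit Arguments.
Unset Strict Implicit.
Unset Printing Implicit Defensive.

Import GroupScope.

Lemma proper_leq_double_card (gT : finGroupType) (H K : {group gT}) :
  H \proper K -> (2 * #|H| <= #|K|)%N.
Proof.
move=> ltHK; have sHK := proper_sub ltHK.
by rewrite -(Lagrange sHK) mulnC leq_mul2l indexg_gt1 proper_subn ?orbT.
Qed.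

Lemma proper_leq_double_cardD (gT : finGroupType) (H K : {group gT}) :
  H \proper K -> (#|K| <= 2 * #|K :\: H|)%N.
Proof.
move=> ltHK; have /setIidPr sHK := proper_sub ltHK.
have := proper_leq_double_card ltHK; rewrite -(cardsID H K) sHK.
by rewrite !mul2n -!addnn leq_add2l leq_add2r.
Qed.

(** The complement [K :\: H] holds at least half of [K] and misses the identity, so the group it
    generates has more than half of the elements, too many for a proper subgroup. *)
Lemma gen_setD_proper (gT : finGroupType) (H K : {group gT}) :
  H \proper K -> <<K :\: H>> = K.
Proof.
move=> ltHK; have sLK : <<K :\: H>> \subset K by rewrite gen_subG subsetDl.
apply/eqP; rewrite eqEproper sLK /=; apply/negP=> /proper_leq_double_card.
apply/negP; rewrite -ltnNge; apply: leq_ltn_trans (proper_leq_double_cardD ltHK) _.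
rewrite ltn_pmul2l //; apply: proper_card; apply/properP.
by split; [apply: subset_gen | exists 1; rewrite ?group1 // inE group1].
Qed.

Lemma sum_card_afix (Omega : finType) (X : {group {perm Omega}}) :
  \sum_(g in X) #|'Fix_'P[g]| = (#|orbit 'P X @: [set: Omega]| * #|X|)%N.
Proof.
rewrite -Frobenius_Cauchy; last by apply/actsP=> g _ x; rewrite !inE.
by apply: eq_bigr => g _; rewrite setTI.
Qed.

Lemma transitive_card_orbits (Omega : finType) (X : {group {perm Omega}}) :
  [transitive X, on [set: Omega] | 'P] -> #|orbit 'P X @: [set: Omega]| = 1%N.
Proof.
case/imsetP=> x _ defT; apply/eqP/cards1P; exists [set: Omega].
apply/setP=> A; rewrite inE; apply/imsetP/eqP=> [[y _ ->] | ->].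
  by rewrite defT; apply/eqP; rewrite orbit_eq_mem -defT inE.
by exists x.
Qed.

(** The point [x] rules out the empty set, which has no orbits and on which
    [[transitive _, on _ | _]] is false. *)
Lemma card_orbits_transitive (Omega : finType) (X : {group {perm Omega}})
    (x : Omega) :
  (#|orbit 'P X @: [set: Omega]| <= 1)%N -> [transitive X, on [set: Omega] | 'P].
Proof.
move/card_le1_eqP=> orb1; apply/imsetP; exists x => //; apply/setP=> y.
by rewrite inE -orbit_eq_mem (orb1 _ _ (imset_f _ (in_setT y)) (imset_f _ (in_setT x))) eqxx.
Qed.

Section OutsideFixedPoints.

Variables (Omega : finType) (G H : {group {perm Omega}}) (alpha : Omega).
Hypothesis sHG : H \subset G.
Hypothesis G_transitive : [transitive G, on [set: Omega] | 'P].
Hypothesis fixD : forall g, g \in G :\: H -> (0 < #|'Fix_'P[g]|)%N.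

(** Orbit counting for the transitive group [G], with the sum split along [H] and orbit counting
    applied again to the part in [H]. *)
Let sum_fixG :
  (#|orbit 'P H @: [set: Omega]| * #|H| + \sum_(g in G :\: H) #|'Fix_'P[g]|
     = #|H| + #|G :\: H|)%N.
Proof.
have /setIidPr defH := sHG; have := cardsID H G; rewrite defH => ->.
rewrite -sum_card_afix.
rewrite -[RHS]mul1n -(transitive_card_orbits G_transitive) -sum_card_afix.
by rewrite [RHS](big_setID H) defH.
Qed.

Let card_orbits_le1 : (#|orbit 'P H @: [set: Omega]| <= 1)%N.
Proof.
rewrite -(leq_pmul2r (cardG_gt0 H)) mul1n -(leq_add2r #|G :\: H|) -sum_fixG.
by rewrite leq_add2l -sum1_card leq_sum.
Qed.

Lemma transitive_of_fix_outside : [transitive H, on [set: Omega] | 'P].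
Proof. exact: (card_orbits_transitive alpha card_orbits_le1). Qed.

Lemma card_fix_outside g : g \in G :\: H -> #|'Fix_'P[g]| = 1%N.
Proof.
move: sum_fixG; rewrite (transitive_card_orbits transitive_of_fix_outside) mul1n.
move/addnI/esym/eqP; rewrite -sum1_card.
(* Equality case: terms that are all at least 1 and sum to their number are all equal to 1. *)
rewrite (leqif_sum (fun g Gg => leqif_eq (fixD Gg))).
by move/forall_inP=> fix1 /fix1/eqP.
Qed.

(** By orbit-stabiliser, since [alpha] has the same orbit, all of [Omega], under both groups. *)
Lemma astab1_proper : H \proper G -> 'C_H[alpha | 'P] \proper 'C_G[alpha | 'P].
Proof.
move=> ltHG; rewrite properEcard setSI //=.
have Talpha := in_setT alpha.
have := proper_card ltHG.
rewrite -(card_orbit_in_stab 'P alpha (subsetT H)).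
rewrite -(card_orbit_in_stab 'P alpha (subsetT G)).
rewrite (atransP G_transitive _ Talpha) (atransP transitive_of_fix_outside _ Talpha).
by rewrite ltn_mul2l => /andP[].
Qed.

Lemma stab_outside_derangements :
  'C_G[alpha | 'P] :\: 'C_H[alpha | 'P]
    \subset derangements [set~ alpha] 'C_G[alpha | 'P].
Proof.
apply/subsetP=> g; rewrite in_setD => /andP[notCHg CGg]; rewrite inE CGg.
have [Gg Cg] := setIP CGg; move: notCHg; rewrite inE Cg andbT => notHg.
have /card_fix_outside/eqP/cards1P[y fix_g] : g \in G :\: H by rewrite inE notHg.
have fixE x : (g x == x) = (x == y).
  by rewrite -[RHS]in_set1 -fix_g; apply/eqP/afix1P.
(* The only fixed point [y] of [g] must be [alpha], which [g] stabilises. *)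
apply/forall_inP=> x; rewrite in_setC1 fixE; apply: contra => /eqP->.
by rewrite eq_sym -fixE; apply/eqP; exact: (astab1P Cg).
Qed.

End OutsideFixedPoints.

Theorem corollary1p3 (Omega : finType) (G : {group {perm Omega}})
    (G_transitive : [transitive G, on [set: Omega] | 'P])
    (DG_neq_G : derangement_subgroup [set: Omega] G <> G)
    (alpha : Omega) :
  (#|'C_G[alpha | 'P]|
    <= 2 * #|derangements [set~ alpha] 'C_G[alpha | 'P]|)%N
  /\ 'C_G[alpha | 'P] = derangement_subgroup [set~ alpha] 'C_G[alpha | 'P].
Proof.
pose D := <<derangements [set: Omega] G>>%G.
have sderG S (X : {group {perm Omega}}) : <<derangements S X>> \subset X.
  by rewrite gen_subG; apply/subsetP=> g; rewrite inE => /andP[].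
have ltDG : D \proper G by rewrite properEneq sderG andbT; apply/eqP.
have fixD g : g \in G :\: D -> (0 < #|'Fix_'P[g]|)%N.
  (* Without fixed points [g] would be one of the generators of [D]. *)
  case/setDP=> Gg; apply: contraR; rewrite -eqn0Ngt cards_eq0 => /eqP fix0.
  rewrite mem_gen // inE Gg; apply/forall_inP=> x _; apply/eqP=> gx.
  by have: x \in 'Fix_'P[g]; [apply/afix1P | rewrite fix0 inE].
have sDG := proper_sub ltDG.
have ltC := astab1_proper alpha sDG G_transitive fixD ltDG.
have sDer := stab_outside_derangements alpha sDG G_transitive fixD.
split.
  apply: leq_trans (proper_leq_double_cardD ltC) _.
  by rewrite leq_mul2l subset_leq_card ?orbT.
by apply/eqP; rewrite eqEsubset sderG andbT -{1}(gen_setD_proper ltC) genS.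
Qed.
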